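(* Let $\mathcal{P} \subset \mathbb{E}^n$ be a discrete point set and let $p \in \mathcal{P} \cap \partial \operatorname{conv}(\mathcal{P})$ be a boundary point of $\mathcal{P}$. If the Voronoi cell $V(p)$ is a polyhedron, then the direction cone $C(p)$ is finitely generated.
   Context: $\mathbb{E}^n$ is $n$-dimensional Euclidean space with Euclidean norm $\|\cdot\|$. A set $\mathcal{P} \subset \mathbb{E}^n$ is discrete if every bounded subset of $\mathbb{E}^n$ contains only finitely many points of $\mathcal{P}$. The Voronoi cell of $p \in \mathcal{P}$ relative to $\mathcal{P}$ is $V(p) := \{ x \in \mathbb{E}^n \mid \|x-p\| \le \|x-q\| \text{ for all } q \in \mathcal{P}\}$. $\operatorname{conv}(\mathcal{P})$ is the convex hull and $\partial M$ the boundary of a set $M$. The direction cone of $p$ is $C(p) := \operatorname{cone}(\mathcal{P}-p) = \{ \sum_{i=1}^m \lambda_i (p_i - p) \mid p_i \in \mathcal{P}, \lambda_i \ge 0, m \in \mathbb{N}\}$. A cone is finitely generated if it equals $\operatorname{cone}(v_1,\dots,v_k)$ for finitely many vectors $v_1,\dots,v_k$. A polyhedron is an intersection of finitely many closed half spaces of $\mathbb{E}^n$. *)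

(* Defs.v *)
From HB Require Import structures.
From mathcomp Require Import all_boot all_order all_algebra.
From mathcomp Require Import boolp classical_sets cardinality reals topology.
From mathcomp Require Import normedtype convex.

Set Implicit Arguments.
Unset Strict Implicit.
Unset Printing Implicit Defensive.
Import Order.TTheory GRing.Theory Num.Theory.
Import numFieldNormedType.Exports.

Local Open Scope classical_set_scope.
Local Open Scope ring_scope.

(* The library norm on ['rV[R]_n] is the sup norm, so the Euclidean one is
   defined here. The topology of ['rV[R]_n] is nevertheless the Euclidean one:
   see [nbhs_enormP]. *)
Definition dotv (R : realType) (n : nat) (x y : 'rV[R]_n) : R :=
  \sum_i x 0 i * y 0 i.

Definition enorm (R : realType) (n : nat) (x : 'rV[R]_n) : R :=
  Num.sqrt (dotv x x).

Lemma nbhs_enormP (R : realType) (n : nat) (x : 'rV[R]_n) (A : set 'rV[R]_n) :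
  nbhs x A <-> exists2 r : R, 0 < r & [set y | enorm (y - x) < r] `<=` A.
Proof.
have le_enorm (z : 'rV[R]_n) i : `|z 0 i| <= enorm z.
  rewrite -sqrtr_sqr ler_sqrt; last first.
    by apply: sumr_ge0 => j _; rewrite -expr2 sqr_ge0.
  rewrite /dotv (bigD1 i)//= -expr2 lerDl.
  by apply: sumr_ge0 => j _; rewrite -expr2 sqr_ge0.
split.
- move=> /nbhs_ballP[e /= e0 eA]; exists e => // y /= ye; apply: eA.
  move: e0 ye => e0 ye; split => // i j; rewrite ord1.
  rewrite /ball/= distrC; apply: le_lt_trans ye.
  by have := le_enorm (y - x) j; rewrite !mxE.
- move=> [r r0 rA].
  have d0 : 0 < r / n.+1%:R by rewrite divr_gt0// ltr0n.
  apply/nbhs_ballP; exists (r / n.+1%:R) => //= y [_ xy]; apply: rA => /=.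
  have -> : r = Num.sqrt (r ^+ 2) by rewrite sqrtr_sqr gtr0_norm.
  rewrite /enorm ltr_sqrt ?exprn_gt0//.
  apply: (@le_lt_trans _ _ (\sum_(i < n) (r / n.+1%:R) ^+ 2)).
    apply: ler_sum => i _; rewrite -expr2 -real_normK ?num_real//.
    rewrite lerXn2r ?nnegrE ?normr_ge0 ?(ltW d0)//.
    by have := xy 0 i; rewrite /ball/= distrC => /ltW; rewrite !mxE.
  rewrite sumr_const card_ord exprMn -[X in X < _]mulr_natr -mulrA.
  rewrite gtr_pMr ?exprn_gt0//.
  rewrite exprVn mulrC ltr_pdivrMr ?exprn_gt0 ?ltr0n// mul1r.
  by rewrite -natrX ltr_nat expnS expn1 mulnS addSn ltnS leq_addr.
Qed.

Definition euclidean_bounded (R : realType) (n : nat) (B : set 'rV[R]_n) :=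
  exists r : R, forall x, B x -> enorm x <= r.

Definition discrete_point_set (R : realType) (n : nat) (P : set 'rV[R]_n) :=
  forall B : set 'rV[R]_n, euclidean_bounded B -> finite_set (P `&` B).

Definition voronoi_cell (R : realType) (n : nat) (P : set 'rV[R]_n)
    (p : 'rV[R]_n) : set 'rV[R]_n :=
  [set x | forall q, P q -> enorm (x - p) <= enorm (x - q)].

Definition convex_hull (R : realType) (n : nat) (P : set 'rV[R]_n) :
    set 'rV[R]_n :=
  smallest [set A | @convex_set R 'rV[R]_n A] P.

Definition boundary (T : topologicalType) (M : set T) : set T :=
  closure M `\` interior M.

Definition cone (R : realType) (n : nat) (X : set 'rV[R]_n) : set 'rV[R]_n :=
  [set x | exists (m : nat) (lambda : 'I_m -> R) (v : 'I_m -> 'rV[R]_n),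
    [/\ forall i, 0 <= lambda i, forall i, X (v i)
      & x = \sum_(i < m) lambda i *: v i]].

Definition direction_cone (R : realType) (n : nat) (P : set 'rV[R]_n)
    (p : 'rV[R]_n) : set 'rV[R]_n :=
  cone [set q - p | q in P].

Definition finitely_generated (R : realType) (n : nat) (C : set 'rV[R]_n) :=
  exists (k : nat) (v : 'I_k -> 'rV[R]_n), C = cone (range v).

Definition closed_half_space (R : realType) (n : nat) (H : set 'rV[R]_n) :=
  exists (a : 'rV[R]_n) (b : R), a != 0 /\ H = [set x | dotv a x <= b].

(* [k = 0] is allowed: the whole space is a polyhedron. *)
Definition polyhedron (R : realType) (n : nat) (A : set 'rV[R]_n) :=
  exists (k : nat) (H : 'I_k -> set 'rV[R]_n),
    (forall i, closed_half_space (H i)) /\ A = \bigcap_(i in [set: 'I_k]) H i.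

(* Main.v *)
(** Translate [p] to the origin and let [X = P - p]; then [V(p)] is the set of
    [x] with [2 <u, x> <= <u, u>] for all [u] in [X].  In a description of
    [V(p)] by finitely many inequalities without redundant members, each
    inequality is active alone at some point [x] of [V(p)], and discreteness
    forces some nonzero [u] in [X] to be active at [x] as well; so the normal of
    the inequality is a positive multiple of [u] and lies in [C(p)].  The
    recession cone of [V(p)] is polar both to [C(p)] and to these finitely many
    normals, hence by Farkas' lemma the normals generate [C(p)]. *)
Require Import Defs.
From mathcomp Require Import all_boot all_order all_algebra.
From mathcomp Require Import boolp classical_sets reals topology normedtype.
From mathcomp Require Import cardinality ring lra.
Import Order.TTheory GRing.Theory Num.Theory.
Import numFieldNormedType.Exports.

Local Open Scope classical_set_scope.
Local Open Scope ring_scope.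

(** * Bilinearity and definiteness of the dot product *)

Section DotProduct.
Context {R : realType} {n : nat}.
Implicit Types (x y z : 'rV[R]_n) (a : R).

Lemma dotvC x y : dotv x y = dotv y x.
Proof. by apply: eq_bigr => i _; rewrite mulrC. Qed.

Lemma dotvDl x y z : dotv (x + y) z = dotv x z + dotv y z.
Proof. by rewrite -big_split; apply: eq_bigr => i _; rewrite !mxE mulrDl. Qed.

Lemma dotvZl a x y : dotv (a *: x) y = a * dotv x y.
Proof. by rewrite mulr_sumr; apply: eq_bigr => i _; rewrite !mxE mulrA. Qed.

Lemma dotvDr x y z : dotv x (y + z) = dotv x y + dotv x z.
Proof. by rewrite dotvC dotvDl !(dotvC x). Qed.

Lemma dotvZr a x y : dotv x (a *: y) = a * dotv x y.
Proof. by rewrite dotvC dotvZl (dotvC x). Qed.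

Lemma dotvNl x y : dotv (- x) y = - dotv x y.
Proof. by rewrite -scaleN1r dotvZl mulN1r. Qed.

Lemma dotvNr x y : dotv x (- y) = - dotv x y.
Proof. by rewrite dotvC dotvNl dotvC. Qed.

Definition dotvE := (dotvDl, dotvDr, dotvZl, dotvZr, dotvNl, dotvNr).

Lemma dotv_ge0 x : 0 <= dotv x x.
Proof. by apply: sumr_ge0 => i _; rewrite -expr2 sqr_ge0. Qed.

Lemma dotv_eq0 x : dotv x x = 0 -> x = 0.
Proof.
move=> /eqP; rewrite psumr_eq0 => [/allP x0|i _]; last first.
  by rewrite -expr2 sqr_ge0.
apply/rowP => i; have := x0 i (mem_index_enum i).
by rewrite mxE /= mulf_eq0 orbb => /eqP.
Qed.

Lemma dotv_gt0 x : x != 0 -> 0 < dotv x x.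
Proof.
move=> x0; rewrite lt_neqAle dotv_ge0 andbT eq_sym.
by apply: contra_neq x0; exact: dotv_eq0.
Qed.

Lemma dotv0r x : dotv x 0 = 0.
Proof. by rewrite -(scale0r 0) dotvZr mul0r. Qed.

End DotProduct.

(** * Convex cones and Farkas' lemma *)

Section Cone.
Context {R : realType} {n : nat}.
Implicit Types (X Q : set 'rV[R]_n) (s : seq 'rV[R]_n).

Lemma cone0 X : cone X 0.
Proof.
by exists 0%N, (fun=> 0), (fun=> 0); split; [case|case|rewrite big_ord0].
Qed.

Lemma coneDZ X (a : R) u x : 0 <= a -> X u -> cone X x -> cone X (a *: u + x).
Proof.
move=> a0 Xu [m [l [v [l0 Xv ->]]]].
exists m.+1, (fun i => if unlift ord0 i is Some j then l j else a),
  (fun i => if unlift ord0 i is Some j then v j else u); split.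
- by move=> i; case: unliftP.
- by move=> i; case: unliftP.
- rewrite big_ord_recl unlift_none; congr (_ + _).
  by apply: eq_bigr => i _; rewrite liftK.
Qed.

(** With [cone0] and [coneDZ] this makes [cone X] an inductively generated set, so indexed sums can
    be avoided from here on. *)
Lemma cone_ind X Q : Q 0 ->
  (forall (a : R) u x, 0 <= a -> X u -> Q x -> Q (a *: u + x)) -> cone X `<=` Q.
Proof.
move=> Q0 QDZ _ [m [l [v [l0 Xv ->]]]].
by apply: big_rec => // i x _; exact: QDZ.
Qed.

Lemma sub_cone X : X `<=` cone X.
Proof.
move=> u Xu; rewrite -[u]scale1r -[_ *: _]addr0.
by apply: coneDZ; last exact: cone0.
Qed.

Lemma coneD X x y : cone X x -> cone X y -> cone X (x + y).
Proof.
move=> + Xy; apply: (cone_ind _ [set x | cone X (x + y)]) => [|a u z a0 Xu].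
  by rewrite /= add0r.
by rewrite /= -addrA; exact: coneDZ.
Qed.

Lemma coneZ X (a : R) x : 0 <= a -> cone X x -> cone X (a *: x).
Proof.
move=> a0; apply: (cone_ind _ [set x | cone X (a *: x)]) => [|b u z b0 Xu].
  by rewrite /= scaler0; exact: cone0.
by rewrite /= scalerDr scalerA; apply: coneDZ; rewrite ?mulr_ge0.
Qed.

Lemma cone_subset X Y : X `<=` cone Y -> cone X `<=` cone Y.
Proof.
move=> XY; apply: cone_ind => [|a u x a0 /XY Yu Yx]; first exact: cone0.
by apply: coneD => //; exact: coneZ.
Qed.

Lemma finitely_generated_seq s : finitely_generated (cone [set` s]).
Proof.
exists (size s), (fun i => s`_i); congr cone.
apply/seteqP; split=> [u /= us|_ [i _ <-]]; last exact: mem_nth.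
have us' : (index u s < size s)%N by rewrite index_mem.
by exists (Ordinal us') => //=; rewrite nth_index.
Qed.

Lemma farkas s w :
  (forall y, (forall u, u \in s -> dotv u y <= 0) -> dotv w y <= 0) ->
  cone [set` s] w.
Proof.
move: {2}(size s) (leqnn (size s)) => m; elim: m s w => [|m IHm] [|b s] w //=.
1,2: move=> _ w0; rewrite (_ : w = 0); first exact: cone0.
1,2: by apply: dotv_eq0; apply/eqP; rewrite eq_le dotv_ge0 w0.
rewrite ltnS => sm wb.
have sub_bs : [set` s] `<=` cone [set` b :: s].
  by move=> u /= us; apply: sub_cone; rewrite /= inE us orbT.
have [ws|/existsNP[y /not_implyP[sy /negP]]] :=
    pselect (forall y, (forall u, u \in s -> dotv u y <= 0) -> dotv w y <= 0).
  by apply: (cone_subset _ _ sub_bs); exact: IHm.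
rewrite -ltNge => wy.
have by0 : 0 < dotv b y.
  rewrite ltNge; apply/negP => by0; move: wy; rewrite ltNge wb// => u.
  by rewrite inE => /predU1P[->//|/sy].
(* The projection along [b] onto the hyperplane orthogonal to [y]. *)
pose f (u : 'rV[R]_n) := u - (dotv u y / dotv b y) *: b.
have : cone [set` map f s] (f w).
  apply: IHm; first by rewrite size_map.
  (* [z'] is the image of [z] under the adjoint of [f]; it is orthogonal to [b], so it is a valid
     test vector for [b :: s]. *)
  move=> z fz; pose z' := z - (dotv b z / dotv b y) *: y.
  have fE u : dotv (f u) z = dotv u z'.
    by rewrite /f /z' !dotvE; ring.
  rewrite fE; apply: wb => u; rewrite inE => /predU1P[->|us].
    by rewrite /z' !dotvE divfK ?gt_eqF// subrr.
  by rewrite -fE fz// map_f.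
(* Each [u] in [s] is [f u] plus a nonpositive multiple of [b], because [<u, y> <= 0 < <b, y>]. *)
have fconeP : cone [set` map f s] `<=`
    [set v | exists2 c, c <= 0 & cone [set` b :: s] (v + c *: b)].
  apply: cone_ind => [|a _ v a0 /= /mapP[u us ->] [c c0 vc]].
    by exists 0 => //; rewrite scale0r addr0; exact: cone0.
  exists (c + a * (dotv u y / dotv b y)).
    by rewrite -oppr_ge0 opprD addr_ge0 ?oppr_ge0// -oppr_ge0 -mulrN mulr_ge0//
      -mulNr divr_ge0 ?oppr_ge0 ?sy// ltW.
  rewrite [X in cone _ X](_ : _ = a *: u + (v + c *: b)).
    by apply: coneDZ => //=; rewrite inE us orbT.
  by apply/rowP => i; rewrite !mxE; ring.
move=> /fconeP[c c0 fwc].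
(* The coefficient of [b] is nonnegative since [c <= 0 < <w, y> / <b, y>]. *)
rewrite (_ : w = (dotv w y / dotv b y - c) *: b + (f w + c *: b)).
  apply: coneDZ => //=; last by rewrite inE eqxx.
  by rewrite subr_ge0 (le_trans c0)// divr_ge0 ?ltW.
by apply/rowP => i; rewrite !mxE; ring.
Qed.

(** Farkas with the single generator [a] gives [u] as a nonnegative multiple of [a]; as [u] is
    nonzero, the factor can be inverted. *)
Lemma farkas1 (a u : 'rV[R]_n) : u != 0 ->
  (forall d, dotv a d <= 0 -> dotv u d <= 0) ->
  exists2 l : R, 0 < l & a = l *: u.
Proof.
move=> u0 au; have : cone [set` [:: a]] u.
  by apply: farkas => d ad; apply: au; apply: ad; rewrite inE.
have coneP : cone [set` [:: a]] `<=`
    [set v | exists2 l : R, 0 <= l & v = l *: a].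
  apply: cone_ind => [|b v _ b0 /= + [l l0 ->]].
    by exists 0; rewrite ?scale0r.
  by rewrite inE => /eqP ->; exists (b + l); rewrite ?addr_ge0 ?scalerDl.
move=> /coneP[l]; rewrite le_eqVlt => /predU1P[<-|l0] uE.
  by move: u0; rewrite uE scale0r eqxx.
by exists l^-1; rewrite ?invr_gt0// uE scalerA mulVf ?scale1r// gt_eqF.
Qed.

End Cone.

(** * Voronoi cell of the origin and its descriptions by half spaces *)

Section Cell.
Context {R : realType} {n : nat}.
Implicit Types (X : set 'rV[R]_n) (s : seq ('rV[R]_n * R)).

(** The condition [|x| <= |x - u|], squared so as to be linear in [x]. *)
Definition cell X : set 'rV[R]_n :=
  [set x | forall u, X u -> 2 * dotv u x <= dotv u u].

Definition locally_finite X :=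
  forall M : R, finite_set (X `&` [set u | dotv u u <= M]).

Definition halfspaces s : set 'rV[R]_n :=
  [set x | forall c, c \in s -> dotv c.1 x <= c.2].

Lemma affine_lt_near0 (a b c : R) : a < b -> \forall t \near 0^'+, a + t * c < b.
Proof.
move=> ab; have c0 : 0 < `|c| + 1 by rewrite ltr_wpDl.
near=> t; have t0 : 0 < t by [].
have : t < (b - a) / (`|c| + 1).
  by near: t; apply: nbhs_right_lt; rewrite divr_gt0 ?subr_gt0.
rewrite ltr_pdivlMr// -ltrBrDl; apply: le_lt_trans.
rewrite ler_pM2l// (le_trans (ler_norm _))//.
by rewrite lerDl.
Unshelve. all: by end_near. Qed.

Lemma near_all_seq (T : eqType) (F : set_system R) {FF : Filter F} (r : seq T)
    (Q : T -> R -> Prop) :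
  (forall u, u \in r -> \forall t \near F, Q u t) ->
  \forall t \near F, forall u, u \in r -> Q u t.
Proof.
elim: r => [|u r IHr] Qr; first by near=> t.
have Qu := Qr u (mem_head _ _).
have {}IHr : \forall t \near F, forall v, v \in r -> Q v t.
  by apply: IHr => v vr; apply: Qr; rewrite inE vr orbT.
near=> t => v; rewrite inE => /predU1P[->|]; first by near: t.
by move: v; near: t.
Unshelve. all: by end_near. Qed.

(** Far points of [X] impose nothing near [x]. Of the finitely many others, slack constraints
    survive a short move and active ones are preserved by the choice of [d]. *)
Lemma cell_near X x d : locally_finite X -> cell X x ->
  (forall u, X u -> 2 * dotv u x = dotv u u -> dotv u d <= 0) ->
  \forall t \near 0^'+, cell X (x + t *: d).
Proof.
(* For [0 < t <= 1], [|x + t d|^2 <= 2 (|x|^2 + |d|^2)]; the far points need four times this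
   bound. *)
move=> Xfin Xx xd; pose M := 8 * (dotv x x + dotv d d).
have /finite_seqP[r rE] := Xfin M.
have Xr u : u \in r -> X u.
  by move=> ur; have : [set` r] u by []; rewrite -rE => -[].
have rt : \forall t \near 0^'+,
    forall u, u \in r -> 2 * dotv u (x + t *: d) <= dotv u u.
  apply: near_all_seq => u /Xr Xu; have := Xx u Xu.
  rewrite le_eqVlt => /predU1P[ux|ux].
    near=> t; have t0 : 0 < t by [].
    have := xd u Xu ux; rewrite -ux !dotvE => ud; nra.
  have := affine_lt_near0 _ _ (2 * dotv u d) ux; apply: filterS => t.
  by rewrite !dotvE => /ltW; lra.
near=> t => u Xu; have t0 : 0 < t by [].
have t1 : t <= 1 by near: t; exact: nbhs_right_le.
have [uM|Mu] := leP (dotv u u) M.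
  have ur : u \in r by have : [set` r] u by rewrite -rE.
  by move: u ur {Xu uM}; near: t.
(* With [z = x + t *: d], [0 <= |u - 2 z|^2] gives
   [2 <u, z> <= (|u|^2 + 4 |z|^2) / 2], and [4 |z|^2 <= M]. *)
have := dotv_ge0 (u - 2 *: (x + t *: d)).
have := dotv_ge0 (x - t *: d).
have : t ^+ 2 * dotv d d <= dotv d d.
  by rewrite ler_piMl ?dotv_ge0// expr_le1// ltW.
move: Mu; rewrite /M !dotvE.
rewrite (dotvC x u) (dotvC d u) (dotvC d x); lra.
Unshelve. all: by end_near. Qed.

Lemma cell0 X : cell X 0.
Proof. by move=> u _; rewrite dotv0r mulr0 dotv_ge0. Qed.

(** Only [u = 0] is active at the origin, so a short move along [c.1] stays in the cell. *)
Lemma halfspaces_gt0 X s c : locally_finite X -> cell X = halfspaces s ->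
  c \in s -> c.1 != 0 -> 0 < c.2.
Proof.
move=> Xfin XE cs c0.
have : \forall t \near (0 : R)^'+, cell X (0 + t *: c.1).
  apply: cell_near => // [|u _]; first exact: cell0.
  by rewrite dotv0r mulr0 => /esym/dotv_eq0 ->; rewrite dotvC dotv0r.
move=> near0; near (0 : R)^'+ => t; have t0 : 0 < t by [].
have : cell X (0 + t *: c.1) by near: t.
rewrite XE => /(_ c cs); rewrite add0r dotvZr; apply: lt_le_trans.
by rewrite mulr_gt0 ?dotv_gt0.
Unshelve. all: by end_near. Qed.

Lemma irredundant_normal X s c : locally_finite X -> cell X = halfspaces s ->
  (forall c', c' \in s -> c'.1 != 0) ->
  c \in s -> cell X <> halfspaces (rem c s) -> cone X c.1.
Proof.
move=> Xfin XE s0 cs cE.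
have remE c' : c' \in s -> c' = c \/ c' \in rem c s.
  by rewrite (perm_mem (perm_to_rem cs)) inE => /predU1P.
have [y [ys cy]] : exists y, halfspaces (rem c s) y /\ c.2 < dotv c.1 y.
  apply: contrapT => /forallNP nH; apply: cE; rewrite XE.
  apply/seteqP; split=> y ys c' c's; first by apply: ys; exact: mem_rem c's.
  have [->|/ys//] := remE _ c's.
  by rewrite leNgt; apply/negP => cy; apply: (nH y).
have sX y' : halfspaces s y' -> cell X y' by rewrite XE.
have Xs y' : cell X y' -> halfspaces s y' by rewrite XE.
have b0 c' (c's : c' \in s) := halfspaces_gt0 _ _ _ Xfin XE c's (s0 _ c's).
have c20 := b0 _ cs; have cy0 := lt_trans c20 cy.
(* Shrinking [y], which violates [c] alone, onto the hyperplane of [c] makes all other constraints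
   strict, as their right-hand sides are positive and [r < 1]. *)
pose r := c.2 / dotv c.1 y; pose x := r *: y.
have r0 : 0 < r by rewrite divr_gt0.
have r1 : r < 1 by rewrite ltr_pdivrMr// mul1r.
have cx : dotv c.1 x = c.2 by rewrite dotvZr divfK// gt_eqF.
have xs c' : c' \in s -> c' = c \/ dotv c'.1 x < c'.2.
  move=> c's; have [->|/ys c'y] := remE _ c's; [by left|right].
  rewrite dotvZr (@le_lt_trans _ _ (r * c'.2))// ?ler_pM2l//.
  by rewrite gtr_pMl ?b0.
have Xx : cell X x.
  by apply: sX => c' /xs[->|/ltW//]; rewrite cx.
(* Otherwise a short move from [x] along [c.1] would stay in the cell yet violate [c]. *)
have [u [Xu ux u0]] :
    exists u, [/\ X u, 2 * dotv u x = dotv u u & u != 0].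
  apply: contrapT => /forallNP nu.
  have : \forall t \near (0 : R)^'+, cell X (x + t *: c.1).
    apply: cell_near => // u Xu ux.
    have [->|u0] := eqVneq u 0; first by rewrite dotvC dotv0r.
    by case: (nu u).
  move=> nearx; near (0 : R)^'+ => t; have t0 : 0 < t by [].
  have /Xs/(_ c cs) : cell X (x + t *: c.1) by near: t.
  by rewrite dotvDr cx dotvZr leNgt ltrDl mulr_gt0 ?dotv_gt0 ?s0.
(* If [<c.1, d> <= 0], a short move along [d] stays in the cell because [c] alone is active at [x];
   the active [u] then forces [<u, d> <= 0]. *)
have [d cd|l l0 ->] := farkas1 c.1 u u0; last first.
  by apply: coneZ; [exact: ltW|exact: sub_cone].
have : \forall t \near (0 : R)^'+,
    forall c', c' \in s -> dotv c'.1 (x + t *: d) <= c'.2.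
  apply: near_all_seq => c' /xs[->|c'x].
    near=> t; have t0 : 0 < t by [].
    by rewrite dotvDr cx dotvZr gerDl pmulr_rle0.
  have := affine_lt_near0 _ _ (dotv c'.1 d) c'x; apply: filterS => t /ltW.
  by rewrite dotvDr dotvZr.
move=> nearx; near (0 : R)^'+ => t; have t0 : 0 < t by [].
have /sX/(_ u Xu) : halfspaces s (x + t *: d) by near: t.
by rewrite dotvDr mulrDr ux gerDl pmulr_rle0// dotvZr pmulr_rle0.
Unshelve. all: by end_near. Qed.

(** Redundant constraints are removed one by one; once none is left, [irredundant_normal] applies to
    each. *)
Lemma cell_halfspaces_normals X s : locally_finite X ->
  cell X = halfspaces s -> (forall c, c \in s -> c.1 != 0) ->
  exists2 s', cell X = halfspaces s' & forall c, c \in s' -> cone X c.1.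
Proof.
move=> Xfin; have [m] := ubnP (size s); elim: m s => // m IHm s sm XE s0.
have [[c cs cE]|irr] :=
    pselect (exists2 c, c \in s & cell X = halfspaces (rem c s)).
  apply: (IHm (rem c s)) => // [|c' c's]; last by apply: s0; exact: mem_rem c's.
  rewrite size_rem// prednK; first by rewrite -ltnS.
  by case: (s) cs.
exists s => // c cs; apply: (irredundant_normal _ _ _ Xfin XE s0 cs) => cE.
by apply: irr; exists c.
Qed.

Lemma cone_finitely_generated X s : locally_finite X ->
  cell X = halfspaces s -> (forall c, c \in s -> c.1 != 0) ->
  finitely_generated (cone X).
Proof.
move=> Xfin XE s0; have [s' {}XE Xs'] := cell_halfspaces_normals _ _ Xfin XE s0.
rewrite (_ : cone X = cone [set` map fst s']); first exact: finitely_generated_seq.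
apply/seteqP; split; apply: cone_subset; last by move=> _ /mapP[c /Xs' Xc ->].
move=> w Xw; apply: farkas => y s'y; rewrite leNgt; apply/negP => wy.
(* [y] is a recession direction of the cell, yet [2 <w, k y> > <w, w>] here. *)
pose k := dotv w w / dotv w y + 1.
have k0 : 0 <= k by rewrite addr_ge0// divr_ge0 ?dotv_ge0// ltW.
have : cell X (k *: y).
  (* The origin lies in the cell, hence [0 <= c.2]. *)
  rewrite XE => c cs'; have : cell X 0 := cell0 X.
  rewrite XE => /(_ c cs'); rewrite dotv0r; apply: le_trans.
  by rewrite dotvZr mulr_ge0_le0// s'y// map_f.
move=> /(_ w Xw); rewrite dotvZr /k [_ * dotv w y]mulrDl mul1r divfK ?gt_eqF//.
by have := dotv_ge0 w; lra.
Qed.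

End Cell.

(** * Translation between [P] at [p] and [P - p] at the origin *)

Lemma le_enorm (R : realType) (n : nat) (x y : 'rV[R]_n) :
  (enorm x <= enorm y) = (dotv x x <= dotv y y).
Proof. by rewrite ler_sqrt ?dotv_ge0. Qed.

Lemma voronoi_cellE (R : realType) (n : nat) (P : set 'rV[R]_n) (p x : 'rV[R]_n) :
  voronoi_cell P p (x + p) = cell [set q - p | q in P] x.
Proof.
have E q : (enorm (x + p - p) <= enorm (x + p - q)) =
    (2 * dotv (q - p) x <= dotv (q - p) (q - p)).
  rewrite le_enorm addrK.
  rewrite (_ : x + p - q = x - (q - p)); last by rewrite opprB addrA addrAC.
  rewrite dotvDl dotvDr dotvNr dotvNl dotvDr dotvNr (dotvC x (q - p)).
  by apply/idP/idP; lra.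
apply/propext; split=> [Vx _ [q Pq <-]|Xx q Pq]; first by rewrite -E Vx.
by rewrite E; apply: Xx; exists q.
Qed.

Lemma discrete_locally_finite (R : realType) (n : nat) (P : set 'rV[R]_n)
  (p : 'rV[R]_n) : discrete_point_set P -> locally_finite [set q - p | q in P].
Proof.
move=> hP M; pose B := [set q | dotv (q - p) (q - p) <= M].
have /hP : euclidean_bounded B.
  (* From [|q|^2 <= 2 |q - p|^2 + 2 |p|^2], which is [0 <= |q - 2 p|^2] rearranged. *)
  exists (Num.sqrt (2 * M + 2 * dotv p p)) => q /= qM.
  have M0 : 0 <= M := le_trans (dotv_ge0 _) qM.
  rewrite ler_sqrt; last by rewrite addr_ge0 ?mulr_ge0 ?dotv_ge0.
  have := dotv_ge0 (q - p - p); move: qM; rewrite /B /= !dotvE (dotvC p q); lra.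
move=> /(finite_image (fun q => q - p)); apply: sub_finite_set.
by move=> _ [[q Pq <-] qM]; exists q.
Qed.

Theorem theorem4p2 (R : realType) (n : nat) (P : set 'rV[R]_n) (p : 'rV[R]_n)
    (hP : discrete_point_set P)
    (hp : (P `&` boundary (convex_hull P)) p)
    (hV : polyhedron (voronoi_cell P p)) :
  finitely_generated (direction_cone P p).
Proof.
have [k [H [Hhalf VE]]] := hV.
have /choice[a /choice[b abH]] :
    forall i, exists a b, a != 0 /\ H i = [set x | dotv a x <= b] := Hhalf.
(* Moving [p] to the origin lowers each right-hand side by [<a i, p>]. *)
pose s := [seq (a i, b i - dotv (a i) p) | i <- enum 'I_k].
apply: (cone_finitely_generated _ s).
- exact: discrete_locally_finite.
- apply/seteqP; split=> x.
    rewrite -voronoi_cellE VE => xH _ /mapP[i _ ->] /=.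
    by have := xH i I; rewrite (abH i).2 /= dotvDr lerBrDr.
  rewrite -voronoi_cellE VE => xs i _; rewrite (abH i).2 /=.
  have /xs : (a i, b i - dotv (a i) p) \in s.
    by apply: map_f; rewrite mem_enum.
  by rewrite dotvDr lerBrDr.
- by move=> _ /mapP[i _ ->]; exact: (abH i).1.
Qed.
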